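(* Let $B\to C\to A$ be unit-preserving algebra homomorphisms. If the algebra extension $A\mid C$ is right D2 and the extension $C\mid B$ is H-separable, then $A\mid B$ is right D2. Likewise, if $A\mid C$ is left D2 and $C\mid B$ is H-separable, then $A\mid B$ is left D2.
   Context: Algebras are unital, associative (not necessarily commutative) over a commutative ground ring $K$. An algebra extension $A\mid B$ is a unit-preserving algebra homomorphism $B\to A$; here $A\mid B$ is the composite $B\to C\to A$. $X\oplus *\cong Y$ means $X$ is isomorphic to a direct summand of $Y$. $C\mid B$ is H-separable if $C\otimes_BC\oplus *\cong C^N$ as $C$-$C$-bimodules for some positive integer $N$. $A\mid B$ is left D2 (respectively right D2) if $A\otimes_BA\oplus *\cong A^N$ for some positive integer $N$ as $B$-$A$-bimodules (respectively $A$-$B$-bimodules). *)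

(* Defs.v *)
From HB Require Import structures.
From mathcomp Require Import all_boot all_algebra.
From mathcomp Require Import boolp.
From mathcomp.multinomials Require Import freeg.

Set Implicit Arguments.
Unset Strict Implicit.
Unset Printing Implicit Defensive.

Import GRing.Theory.
Local Open Scope ring_scope.
Local Open Scope quotient_scope.

(* [algType] requires 1 != 0; to allow the zero algebra, a K-algebra is here a
   ring with a ring homomorphism from K to its center. *)
HB.mixin Record PzRing_isPzAlgebra (K : comPzRingType) A of GRing.PzRing A := {
  in_pzalg : {rmorphism K -> A};
  in_pzalgC : forall (k : K) (x : A), in_pzalg k * x = x * in_pzalg k
}.
#[short(type="pzAlgType")]
HB.structure Definition PzAlgebra (K : comPzRingType) :=
  {A of GRing.PzRing A & PzRing_isPzAlgebra K A}.

HB.mixin Record isPzAlgMorphism (K : comPzRingType) (A B : pzAlgType K)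
    (f : A -> B) := {
  pzalg_morph : forall k : K, f (in_pzalg k) = in_pzalg k
}.
HB.structure Definition PzAlgMorphism (K : comPzRingType) (A B : pzAlgType K) :=
  {f of @GRing.RMorphism A B f & isPzAlgMorphism K A B f}.
Notation "{ 'pzalgmorphism' A -> B }" := (@PzAlgMorphism.type _ A%type B%type)
  (at level 0, A at level 98, B at level 99,
   format "{ 'pzalgmorphism'  A  ->  B }") : type_scope.

HB.instance Definition _ (K : comPzRingType) (A : pzAlgType K) :=
  isPzAlgMorphism.Build K A A idfun (fun=> erefl).

Fact pzalg_morph_comp (K : comPzRingType) (A B C : pzAlgType K)
    (f : {pzalgmorphism B -> C}) (g : {pzalgmorphism A -> B}) (k : K) :
  (f \o g) (in_pzalg k) = in_pzalg k.
Proof. by rewrite /= !pzalg_morph. Qed.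
HB.instance Definition _ (K : comPzRingType) (A B C : pzAlgType K)
    (f : {pzalgmorphism B -> C}) (g : {pzalgmorphism A -> B}) :=
  isPzAlgMorphism.Build K A C (f \o g) (pzalg_morph_comp f g).

Definition of_algType (K : comPzRingType) (A : algType K) : Type := A.
HB.instance Definition _ (K : comPzRingType) (A : algType K) :=
  GRing.PzRing.on (of_algType A).
Fact of_algTypeC (K : comPzRingType) (A : algType K) (k : K) (x : A) :
  k%:A * x = x * k%:A.
Proof. by rewrite -scalerAl -scalerAr mul1r mulr1. Qed.
HB.instance Definition _ (K : comPzRingType) (A : algType K) :=
  PzRing_isPzAlgebra.Build K (of_algType A)
    (in_pzalg := in_alg A : {rmorphism K -> A}) (@of_algTypeC K A).

(* The last axiom says that the two induced actions of K agree, as is customary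
   for bimodules over K-algebras. *)
Record bimod (K : comPzRingType) (R S : pzAlgType K) := Bimod {
  bimod_sort :> zmodType;
  lact : R -> bimod_sort -> bimod_sort;
  ract : bimod_sort -> S -> bimod_sort;
  lactDl : forall r r' x, lact (r + r') x = lact r x + lact r' x;
  lactDr : forall r x y, lact r (x + y) = lact r x + lact r y;
  lactM : forall r r' x, lact (r * r') x = lact r (lact r' x);
  lact1 : forall x, lact 1 x = x;
  ractDl : forall x y s, ract (x + y) s = ract x s + ract y s;
  ractDr : forall x s s', ract x (s + s') = ract x s + ract x s';
  ractM : forall x s s', ract x (s * s') = ract (ract x s) s';
  ract1 : forall x, ract x 1 = x;
  lract : forall r x s, ract (lact r x) s = lact r (ract x s);
  bimodZ : forall (k : K) x, lact (in_pzalg k) x = ract x (in_pzalg k)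
}.

Section Basic.
Variables (K : comPzRingType) (R S : pzAlgType K).

Record bimod_hom (X Y : bimod R S) (f : X -> Y) : Prop := BimodHom {
  bimod_homD : {morph f : x y / x + y};
  bimod_homl : forall r x, f (lact r x) = lact r (f x);
  bimod_homr : forall x s, f (ract x s) = ract (f x) s
}.

Definition bimod_iso (X Y : bimod R S) : Prop :=
  exists2 f : X -> Y, bimod_hom f & bijective f.

Definition bimod_sum (X Y : bimod R S) : bimod R S.
Proof.
apply: (@Bimod K R S (X * Y)%type
  (fun r x => (lact r x.1, lact r x.2)) (fun x s => (ract x.1 s, ract x.2 s))).
- by move=> r r' x; rewrite !lactDl.
- by move=> r x y; rewrite /= !lactDr.
- by move=> r r' x; rewrite /= !lactM.
- by case=> x y; rewrite /= !lact1.
- by move=> x y s; rewrite /= !ractDl.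
- by move=> x s s'; rewrite /= !ractDr.
- by move=> x s s'; rewrite /= !ractM.
- by case=> x y; rewrite /= !ract1.
- by move=> r x s; rewrite /= !lract.
- by move=> k x; rewrite /= !bimodZ.
Defined.

Definition bimod_pow (X : bimod R S) (N : nat) : bimod R S.
Proof.
apply: (@Bimod K R S {ffun 'I_N -> X}
  (fun r x => [ffun i => lact r (x i)]) (fun x s => [ffun i => ract (x i) s])).
- by move=> r r' x; apply/ffunP=> i; rewrite !ffunE lactDl.
- by move=> r x y; apply/ffunP=> i; rewrite !ffunE lactDr.
- by move=> r r' x; apply/ffunP=> i; rewrite !ffunE lactM.
- by move=> x; apply/ffunP=> i; rewrite !ffunE lact1.
- by move=> x y s; apply/ffunP=> i; rewrite !ffunE ractDl.
- by move=> x s s'; apply/ffunP=> i; rewrite !ffunE ractDr.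
- by move=> x s s'; apply/ffunP=> i; rewrite !ffunE ractM.
- by move=> x; apply/ffunP=> i; rewrite !ffunE ract1.
- by move=> r x s; apply/ffunP=> i; rewrite !ffunE lract.
- by move=> k x; apply/ffunP=> i; rewrite !ffunE bimodZ.
Defined.

(* X (+) * ~= Y *)
Definition iso_summand (X Y : bimod R S) : Prop :=
  exists Z : bimod R S, bimod_iso (bimod_sum X Z) Y.

(* A as an R-S-bimodule: r . a . s = f r * a * g s *)
Definition alg_bimod (A : pzAlgType K)
  (f : {pzalgmorphism R -> A}) (g : {pzalgmorphism S -> A}) : bimod R S.
Proof.
apply: (@Bimod K R S A (fun r a => f r * a) (fun a s => a * g s)).
- by move=> r r' x; rewrite rmorphD mulrDl.
- by move=> r x y; rewrite mulrDr.
- by move=> r r' x; rewrite rmorphM mulrA.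
- by move=> x; rewrite rmorph1 mul1r.
- by move=> x y s; rewrite mulrDl.
- by move=> x s s'; rewrite rmorphD mulrDr.
- by move=> x s s'; rewrite rmorphM mulrA.
- by move=> x; rewrite rmorph1 mulr1.
- by move=> r x s; rewrite mulrA.
- by move=> k x; rewrite !pzalg_morph in_pzalgC.
Defined.

End Basic.

(* X (x)_S Y: the free abelian group on X * Y modulo the subgroup generated by
   the usual relations. *)
Section Tensor.
Variables (K : comPzRingType) (R S T : pzAlgType K).
Variables (X : bimod R S) (Y : bimod S T).

Local Notation F := {freeg (X * Y)%type / int}.

Inductive tensor_rel : F -> Prop :=
| tensor_rel0 : tensor_rel 0
| tensor_relB u v : tensor_rel u -> tensor_rel v -> tensor_rel (u - v)
| tensor_relDl x x' y :
    tensor_rel (<<(x + x', y)>> - (<<(x, y)>> + <<(x', y)>>))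
| tensor_relDr x y y' :
    tensor_rel (<<(x, y + y')>> - (<<(x, y)>> + <<(x, y')>>))
| tensor_relM x s y : tensor_rel (<<(ract x s, y)>> - <<(x, lact s y)>>).

Definition tensor_null : {pred F} := fun u => `[< tensor_rel u >].

Fact zmod_morphism_fglift (V : lmodType int) (h : X * Y -> V) :
  zmod_morphism (fglift h : F -> V).
Proof. exact: lift_is_additive. Qed.

Fact tensor_null_zmod : zmod_closed tensor_null.
Proof.
split=> [|u v /asboolP Hu /asboolP Hv]; apply/asboolP; first exact: tensor_rel0.
exact: tensor_relB.
Qed.
HB.instance Definition _ := GRing.isZmodClosed.Build F tensor_null
  tensor_null_zmod.

Definition tensor_sort : Type := Quotient.quot tensor_null.
HB.instance Definition _ := Choice.on tensor_sort.
HB.instance Definition _ := GRing.Zmodule.on tensor_sort.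
HB.instance Definition _ : EqQuotient F (Quotient.equiv tensor_null) tensor_sort
  := EqQuotient.on tensor_sort.
HB.instance Definition _ :
    ZmodQuotient F (Quotient.equiv tensor_null) 0 -%R +%R tensor_sort :=
  ZmodQuotient.on tensor_sort.

Definition tens (x : X) (y : Y) : tensor_sort := \pi_tensor_sort <<(x, y)>>.

Record balanced (V : zmodType) (b : X -> Y -> V) : Prop := Balanced {
  balancedDl : forall x x' y, b (x + x') y = b x y + b x' y;
  balancedDr : forall x y y', b x (y + y') = b x y + b x y';
  balancedM : forall x s y, b (ract x s) y = b x (lact s y)
}.

(* The map x (x) y |-> b x y, for balanced b. *)
Definition tensor_lift (V : zmodType) (b : X -> Y -> V) (t : tensor_sort) : V :=
  fglift (fun p => b p.1 p.2 : zmodule V) (repr t).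

Lemma tensor_piP (u v : F) :
  tensor_rel (u - v) <-> \pi_tensor_sort u = \pi_tensor_sort v.
Proof.
split=> [H | /eqP].
  by apply/eqP; rewrite -Quotient.idealrBE; apply/asboolP.
by rewrite -Quotient.idealrBE => /asboolP.
Qed.

Lemma tens_balanced : balanced tens.
Proof.
split=> [x x' y|x y y'|x s y]; rewrite /tens -?raddfD; apply/tensor_piP.
- exact: tensor_relDl.
- exact: tensor_relDr.
- exact: tensor_relM.
Qed.

Lemma tensor_lift_pi (V : zmodType) (b : X -> Y -> V) (u : F) : balanced b ->
  tensor_lift b (\pi_tensor_sort u) = fglift (fun p => b p.1 p.2 : zmodule V) u.
Proof.
case=> bDl bDr bM; rewrite /tensor_lift; set h := fglift _.
have hB v w : h (v - w) = h v - h w by exact: zmod_morphism_fglift.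
have h0 : h 0 = 0 by rewrite -(subrr 0) hB subrr.
have hD v w : h (v + w) = h v + h w.
  by rewrite -[w in LHS]opprK hB -sub0r hB h0 sub0r opprK.
have hU x y : h <<(x, y)>> = b x y by rewrite /h liftU scale1r.
suff h_rel w : tensor_rel w -> h w = 0.
  apply/eqP; rewrite -subr_eq0 -hB; apply/eqP/h_rel.
  by apply/tensor_piP; rewrite reprK.
elim=> [|v w' _ hv _ hw|x x' y|x y y'|x s y]; rewrite ?hB ?hD //.
- by rewrite hv hw subr0.
- by rewrite !hU bDl subrr.
- by rewrite !hU bDr subrr.
- by rewrite !hU bM subrr.
Qed.

Lemma tensor_liftE (V : zmodType) (b : X -> Y -> V) x y : balanced b ->
  tensor_lift b (tens x y) = b x y.
Proof. by move=> hb; rewrite tensor_lift_pi // liftU scale1r. Qed.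

Lemma tensor_liftB (V : zmodType) (b : X -> Y -> V) : balanced b ->
  {morph tensor_lift b : t t' / t - t'}.
Proof.
move=> hb; elim/quotW=> u; elim/quotW=> v.
rewrite -[X in tensor_lift b X = _]raddfB !tensor_lift_pi //.
exact: (@zmod_morphism_fglift (zmodule V)).
Qed.

Lemma tensor_liftD (V : zmodType) (b : X -> Y -> V) : balanced b ->
  {morph tensor_lift b : t t' / t + t'}.
Proof.
move=> hb t t'; have hB := tensor_liftB hb.
have h0 : tensor_lift b 0 = 0 by rewrite -[0 in LHS]subr0 hB subrr.
have hN u : tensor_lift b (- u) = - tensor_lift b u.
  by rewrite -[- u]sub0r hB h0 sub0r.
by rewrite -[t' in LHS]opprK [LHS]hB hN opprK.
Qed.

Lemma tensor_ind (P : tensor_sort -> Prop) :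
  P 0 -> (forall t t', P t -> P t' -> P (t - t')) -> (forall x y, P (tens x y)) ->
  forall t, P t.
Proof.
move=> P0 PB Ptens; elim/quotW=> u.
have PD t t' : P t -> P t' -> P (t + t').
  move=> Pt Pt'; rewrite -[t']opprK; apply: (PB) => //.
  by rewrite -sub0r; apply: PB.
rewrite -[u]freeg_sumE raddf_sum.
have PM t n : P t -> P (t *+ n).
  by move=> Pt; elim: n => [|n IHn]; rewrite ?mulr0n // mulrS; apply: PD.
elim/big_ind: _ => // -[x y] _.
rewrite -[coeff _ _]intz -freegU_mulz raddfMz; case: (coeff _ _) => n; first exact/PM/Ptens.
by rewrite NegzE mulrNz -sub0r; apply/PB/PM/Ptens.
Qed.

Lemma tensor_lift0 (V : zmodType) (b : X -> Y -> V) : balanced b ->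
  tensor_lift b 0 = 0.
Proof. by move=> hb; rewrite -[0 in LHS]subr0 tensor_liftB // subrr. Qed.

Fact balanced_lact r : balanced (fun x y => tens (lact r x) y).
Proof.
have [tDl tDr tM] := tens_balanced.
split=> [x x' y|x y y'|x s y]; first by rewrite lactDr tDl.
  by rewrite tDr.
by rewrite -lract tM.
Qed.

Fact balanced_ract s : balanced (fun x y => tens x (ract y s)).
Proof.
have [tDl tDr tM] := tens_balanced.
split=> [x x' y|x y y'|x s' y]; first by rewrite tDl.
  by rewrite ractDl tDr.
by rewrite lract tM.
Qed.

Definition tensor_lact (r : R) : tensor_sort -> tensor_sort :=
  tensor_lift (fun x y => tens (lact r x) y).
Definition tensor_ract (t : tensor_sort) (s : T) : tensor_sort :=
  tensor_lift (fun x y => tens x (ract y s)) t.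

Let tlE r x y : tensor_lact r (tens x y) = tens (lact r x) y.
Proof. exact/tensor_liftE/balanced_lact. Qed.
Let trE x y s : tensor_ract (tens x y) s = tens x (ract y s).
Proof. exact: tensor_liftE (balanced_ract s). Qed.
Let tlB r : {morph tensor_lact r : t t' / t - t'}.
Proof. exact/tensor_liftB/balanced_lact. Qed.
Let trB s : {morph tensor_ract^~ s : t t' / t - t'}.
Proof. exact/tensor_liftB/balanced_ract. Qed.
Let tl0 r : tensor_lact r 0 = 0.
Proof. exact/tensor_lift0/balanced_lact. Qed.
Let tr0 s : tensor_ract 0 s = 0.
Proof. exact: tensor_lift0 (balanced_ract s). Qed.

Definition tensor : bimod R T.
Proof.
apply: (@Bimod K R T tensor_sort tensor_lact tensor_ract).
- move=> r r'; elim/tensor_ind=> [|t t' Ht Ht'|x y].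
  + by rewrite !tl0 addr0.
  + by rewrite !tlB Ht Ht' opprD addrACA.
  + by rewrite !tlE lactDl (balancedDl tens_balanced).
- by move=> r t t'; apply/tensor_liftD/balanced_lact.
- move=> r r'; elim/tensor_ind=> [|t t' Ht Ht'|x y].
  + by rewrite !tl0.
  + by rewrite !tlB Ht Ht'.
  + by rewrite !tlE lactM.
- elim/tensor_ind=> [|t t' Ht Ht'|x y]; first by rewrite tl0.
  + by rewrite tlB Ht Ht'.
  + by rewrite tlE lact1.
- by move=> t t' s; apply: (tensor_liftD (balanced_ract s)).
- move=> + s s'; elim/tensor_ind=> [|t t' Ht Ht'|x y].
  + by rewrite !tr0 addr0.
  + by rewrite !trB Ht Ht' opprD addrACA.
  + by rewrite !trE ractDr (balancedDr tens_balanced).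
- move=> + s s'; elim/tensor_ind=> [|t t' Ht Ht'|x y].
  + by rewrite !tr0.
  + by rewrite !trB Ht Ht'.
  + by rewrite !trE ractM.
- elim/tensor_ind=> [|t t' Ht Ht'|x y]; first by rewrite tr0.
  + by rewrite trB Ht Ht'.
  + by rewrite trE ract1.
- move=> r + s; elim/tensor_ind=> [|t t' Ht Ht'|x y].
  + by rewrite tl0 !tr0 tl0.
  + by rewrite !(tlB, trB) Ht Ht'.
  + by rewrite !(tlE, trE).
- move=> k; elim/tensor_ind=> [|t t' Ht Ht'|x y]; first by rewrite tl0 tr0.
  + by rewrite tlB trB Ht Ht'.
  + by rewrite tlE trE bimodZ (balancedM tens_balanced) bimodZ.
Defined.

Lemma lact_tens r x y : lact r (tens x y : tensor) = tens (lact r x) y.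
Proof. exact: tlE. Qed.

Lemma ract_tens x y s : ract (tens x y : tensor) s = tens x (ract y s).
Proof. exact: trE. Qed.

End Tensor.

Section Extensions.
Variables (K : comPzRingType) (A B : pzAlgType K).
Variable f : {pzalgmorphism B -> A}.

Definition Hseparable : Prop := exists2 N : nat, (0 < N)%N &
  iso_summand (tensor (alg_bimod idfun f) (alg_bimod f idfun))
              (bimod_pow (alg_bimod idfun idfun) N).

Definition left_D2 : Prop := exists2 N : nat, (0 < N)%N &
  iso_summand (tensor (alg_bimod f f) (alg_bimod f idfun))
              (bimod_pow (alg_bimod f idfun) N).

Definition right_D2 : Prop := exists2 N : nat, (0 < N)%N &
  iso_summand (tensor (alg_bimod idfun f) (alg_bimod f f))
              (bimod_pow (alg_bimod idfun f) N).

End Extensions.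

(* Main.v *)
Require Import Defs.
From HB Require Import structures.
From mathcomp Require Import all_boot all_algebra.

Set Implicit Arguments.
Unset Strict Implicit.
Unset Printing Implicit Defensive.

Import GRing.Theory.
Local Open Scope ring_scope.

(** That [X] is a direct summand of a finite power of [Y] means that the
    identity of [X] is a finite sum of composites [X -> Y -> X] of bimodule
    morphisms; this relation, [dominated X Y], is visibly transitive, and
    [dominatedP] identifies it with the summands of the definitions of
    H-separability and of depth two.

    Both halves of the theorem follow from one fact
    ([dominated_Hseparable]): if [C | B] is H-separable, then
    A (x)_B A is dominated by A (x)_C A, whatever algebras act on the two
    outer sides.  Conceptually, A (x)_B A = A (x)_C (C (x)_B C) (x)_C A, and
    C (x)_B C is a summand of C^N.  In terms of elements, H-separability
    provides r_k in C commuting with the image of B and e_k in C (x)_B C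
    commuting with C such that the sum of the r_k e_k is 1 (x) 1.  Hence the maps

      x (x)_B y |-> x r_k (x)_C y   and   x (x)_C y |-> x e_k y

    are well defined, and the sum over k of their composites sends
    x (x)_B y to x (1 (x) 1) y = x (x)_B y.

    The depth two condition on [A | C] says that A (x)_C A is dominated
    by A over A and C, on the appropriate sides; restricting the action of C
    to B ([dominated_restrict]) and using transitivity gives the same for
    A (x)_B A over A and B. *)

(** * Additive maps *)

Section Additive.
Variables (U V : zmodType) (h : U -> V).
Hypothesis hD : {morph h : x y / x + y}.

Lemma morphD0 : h 0 = 0.
Proof. by apply: (addrI (h 0)); rewrite -hD !addr0. Qed.

Lemma morphDB : {morph h : x y / x - y}.
Proof. by move=> x y; apply: (addIr (h y)); rewrite -hD !subrK. Qed.

Lemma morphD_sum (I : finType) (F : I -> U) :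
  h (\sum_k F k) = \sum_k h (F k).
Proof. exact: (big_morph h hD morphD0). Qed.

End Additive.

Lemma morphD_sumf (U V : zmodType) (I : finType) (h : I -> U -> V) :
  (forall k, {morph h k : x y / x + y}) ->
  {morph (fun x => \sum_k h k x) : x y / x + y}.
Proof.
move=> hD x y; rewrite /= -big_split.
by apply: eq_bigr => k _; rewrite hD.
Qed.

(** * Direct summands of finite powers *)

Section Kernel.
Variables (K : comPzRingType) (R S : pzAlgType K) (X Y : bimod R S).
Variable h : Y -> X.

(** The proof that [h] is a morphism is an argument so that the closure
    property below can be attached to the predicate. *)
Definition ker_pred of bimod_hom h : {pred Y} := fun y => h y == 0.

Variable hom_h : bimod_hom h.

Fact ker_pred_zmod : zmod_closed (ker_pred hom_h).
Proof.
have hD := bimod_homD hom_h.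
split=> [|x y]; rewrite !unfold_in ?(morphD0 hD) // (morphDB hD).
by move=> /eqP-> /eqP->; rewrite subrr.
Qed.
HB.instance Definition _ :=
  GRing.isZmodClosed.Build Y (ker_pred hom_h) ker_pred_zmod.

Definition ker_sort : Type := {y : Y | y \in ker_pred hom_h}.
HB.instance Definition _ := SubChoice.on ker_sort.
HB.instance Definition _ := [SubChoice_isSubZmodule of ker_sort by <:].

Fact ker_lact r (z : ker_sort) : lact r (val z) \in ker_pred hom_h.
Proof.
case: z => z /= /eqP hz; rewrite unfold_in (bimod_homl hom_h) hz.
by rewrite (morphD0 (lactDr r)).
Qed.

Fact ker_ract (z : ker_sort) s : ract (val z) s \in ker_pred hom_h.
Proof.
case: z => z /= /eqP hz; rewrite unfold_in (bimod_homr hom_h) hz.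
by rewrite (morphD0 (fun x y => ractDl x y s)).
Qed.

Definition ker_bimod : bimod R S.
Proof.
apply: (@Bimod K R S ker_sort
  (fun r z => Sub (lact r (val z)) (ker_lact r z) : ker_sort)
  (fun z s => Sub (ract (val z) s) (ker_ract z s) : ker_sort)).
- by move=> *; apply/val_inj; rewrite /= lactDl.
- by move=> *; apply/val_inj; rewrite /= lactDr.
- by move=> *; apply/val_inj; rewrite /= lactM.
- by move=> *; apply/val_inj; rewrite /= lact1.
- by move=> *; apply/val_inj; rewrite /= ractDl.
- by move=> *; apply/val_inj; rewrite /= ractDr.
- by move=> *; apply/val_inj; rewrite /= ractM.
- by move=> *; apply/val_inj; rewrite /= ract1.
- by move=> *; apply/val_inj; rewrite /= lract.
- by move=> *; apply/val_inj; rewrite /= bimodZ.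
Defined.

End Kernel.

Section Summands.
Variables (K : comPzRingType) (R S : pzAlgType K).
Implicit Types X Y V : bimod R S.

Lemma bimod_hom_comp X Y V (f : Y -> V) (g : X -> Y) :
  bimod_hom f -> bimod_hom g -> bimod_hom (f \o g).
Proof.
by case=> fD fl fr [gD gl gr]; split=> [x y|r x|x s];
  rewrite /= ?(gD, gl, gr) ?(fD, fl, fr).
Qed.

(** A split monomorphism has a complement in its target: the kernel of the
    retraction. *)
Lemma iso_summandP X Y :
  iso_summand X Y <->
  exists s : X -> Y, exists r : Y -> X,
    [/\ bimod_hom s, bimod_hom r & cancel s r].
Proof.
split=> [[Z [f [fD fl fr] [g fK gK]]] | [s [r [hs hr sK]]]].
  have gD : {morph g : x y / x + y}.
    by move=> x y; apply: (can_inj fK); rewrite fD !gK.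
  exists (fun x => f (x, 0)), (fun y => (g y).1); split.
  - split=> [x y|r x|x s]; rewrite -?(fD, fl, fr); congr f.
    + by congr pair; rewrite addr0.
    + by congr pair; rewrite /= (morphD0 (lactDr r)).
    + by congr pair; rewrite /= (morphD0 (fun x y => ractDl x y s)).
  - split=> [x y|r y|y s]; first by rewrite gD.
    + by rewrite -{1}[y]gK -fl fK.
    + by rewrite -{1}[y]gK -fr fK.
  - by move=> x; rewrite fK.
exists (ker_bimod hr), (fun z : X * ker_bimod hr => s z.1 + val z.2).
  case: hs => sD sl sr; split=> [x y|a x|x a] /=.
  - by rewrite sD addrACA.
  - by rewrite sl lactDr.
  - by rewrite sr ractDl.
have rD := bimod_homD hr; have sD := bimod_homD hs.
have ker_y y : y - s (r y) \in ker_pred hr.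
  by rewrite unfold_in (morphDB rD) sK subrr.
exists (fun y => (r y, Sub (y - s (r y)) (ker_y y) : ker_sort hr)).
  case=> x [z zP]; have /eqP hz : r z == 0 := zP.
  have rE : r (s x + z) = x by rewrite rD sK hz addr0.
  by congr pair; [|apply: val_inj]; rewrite /= rE // addrC addKr.
by move=> y; rewrite /= addrC subrK.
Qed.

(** Summands of powers through the maps only: the pairs [f k], [g k] are the
    components of a section and a retraction.  An arbitrary finite index type
    makes transitivity a double sum over a product. *)
Definition dominated X Y : Prop :=
  exists (I : finType) (f : I -> X -> Y) (g : I -> Y -> X),
  [/\ (0 < #|I|)%N, forall k, bimod_hom (f k), forall k, bimod_hom (g k)
    & forall x, \sum_k g k (f k x) = x].

Lemma dominatedP X Y :
  dominated X Y <->
  exists2 N : nat, (0 < N)%N & iso_summand X (bimod_pow Y N).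
Proof.
split=> [[I [f [g [I_gt0 hf hg gfK]]]] | [N N_gt0 /iso_summandP[s [r [hs hr sK]]]]].
  exists #|I| => //; apply/iso_summandP.
  exists (fun x => [ffun k => f (enum_val k) x]),
         (fun y : {ffun 'I_#|I| -> Y} => \sum_k g (enum_val k) (y k)); split.
  - split=> [x y|a x|x a]; apply/ffunP=> k; rewrite !ffunE.
    + exact: bimod_homD.
    + exact: bimod_homl.
    + exact: bimod_homr.
  - split=> [x y|a x|x a].
    + rewrite -big_split; apply: eq_bigr => k _ /=.
      by rewrite ffunE (bimod_homD (hg _)).
    + rewrite (morphD_sum (lactDr a)); apply: eq_bigr => k _ /=.
      by rewrite ffunE (bimod_homl (hg _)).
    + rewrite (morphD_sum (fun x y => ractDl x y a)); apply: eq_bigr => k _ /=.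
      by rewrite ffunE (bimod_homr (hg _)).
  - move=> x; rewrite -[RHS]gfK [RHS](reindex_onto enum_val enum_rank) /=;
      last by move=> k _; rewrite enum_rankK.
    apply: eq_big => [k|k _]; first by rewrite enum_valK eqxx.
    by rewrite ffunE.
pose single k y : bimod_pow Y N := [ffun l => if l == k then y else 0].
exists 'I_N, (fun k x => (s x : {ffun 'I_N -> Y}) k), (fun k y => r (single k y)).
split.
- by rewrite card_ord.
- move=> k; split=> [x y|a x|x a].
  + by rewrite (bimod_homD hs) ffunE.
  + by rewrite (bimod_homl hs) ffunE.
  + by rewrite (bimod_homr hs) ffunE.
- move=> k; apply: (bimod_hom_comp hr).
  split=> [x y|a x|x a]; apply/ffunP=> l; rewrite !ffunE; case: eqP => // _.
  + by rewrite addr0.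
  + by rewrite (morphD0 (lactDr a)).
  + by rewrite (morphD0 (fun x y => ractDl x y a)).
- move=> x; rewrite -[RHS]sK -(morphD_sum (bimod_homD hr)); congr r.
  apply/ffunP=> l; rewrite sum_ffunE (bigD1 l) //= ffunE eqxx big1 ?addr0 //.
  by move=> k /negPf; rewrite ffunE eq_sym => ->.
Qed.

Lemma dominated_trans X Y V : dominated X Y -> dominated Y V -> dominated X V.
Proof.
move=> [I [f [g [I_gt0 hf hg gfK]]]] [J [f' [g' [J_gt0 hf' hg' gfK']]]].
exists (I * J)%type, (fun k => f' k.2 \o f k.1), (fun k => g k.1 \o g' k.2).
split=> [|k|k|x].
- by rewrite card_prod muln_gt0 I_gt0.
- exact: bimod_hom_comp.
- exact: bimod_hom_comp.
rewrite -[RHS]gfK -(pair_bigA _ (fun k l => g k (g' l (f' l (f k x))))) /=.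
by apply: eq_bigr => k _; rewrite -(morphD_sum (bimod_homD (hg k))) gfK'.
Qed.

End Summands.

(** * Maps out of a tensor product *)

Section TensorMaps.
Variables (K : comPzRingType) (R S T : pzAlgType K).
Variables (X : bimod R S) (Y : bimod S T).

(** Most identities below are checked on pure tensors through this lemma. *)
Lemma tensor_ext (V : zmodType) (h h' : tensor_sort X Y -> V) :
  {morph h : t t' / t + t'} -> {morph h' : t t' / t + t'} ->
  (forall x y, h (tens x y) = h' (tens x y)) -> h =1 h'.
Proof.
move=> hD h'D hE; elim/tensor_ind=> [|t t' ht ht'|x y]; last exact: hE.
  by rewrite !morphD0.
by rewrite !morphDB // ht ht'.
Qed.

Lemma lactD_tensor r (t t' : tensor_sort X Y) :
  tensor_lact r (t + t') = tensor_lact r t + tensor_lact r t'.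
Proof. exact: (@lactDr _ _ _ (tensor X Y)). Qed.

Lemma ractD_tensor s (t t' : tensor_sort X Y) :
  tensor_ract (t + t') s = tensor_ract t s + tensor_ract t' s.
Proof. exact: (@ractDl _ _ _ (tensor X Y)). Qed.

Lemma tensor_lift_hom (Z : bimod R T) (b : X -> Y -> Z) :
  balanced b ->
  (forall r x y, b (lact r x) y = lact r (b x y)) ->
  (forall x y s, b x (ract y s) = ract (b x y) s) ->
  bimod_hom (tensor_lift b : tensor X Y -> Z).
Proof.
move=> hb bl br; have bD := tensor_liftD hb.
split=> [//|r|+ s]; apply: tensor_ext.
- by move=> t t'; rewrite lactDr bD.
- by move=> t t'; rewrite bD lactDr.
- by move=> x y; rewrite lact_tens !tensor_liftE.
- by move=> t t'; rewrite ractDl bD.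
- by move=> t t'; rewrite bD ractDl.
- by move=> x y; rewrite ract_tens !tensor_liftE.
Qed.

End TensorMaps.

(** * Change of the outer algebras *)

Section ChangeOfSides.
Variables (K : comPzRingType) (A C : pzAlgType K) (j : {pzalgmorphism C -> A}).

(** The algebras acting on the outside do not enter the relations of a tensor
    product, so the carriers of the tensor products over [C] of [A] with itself
    for different outer actions are the same group, by x (x) y |-> x (x) y.
    They are nevertheless distinct types, whence an explicit map. *)
Section Identity.
Variables (R T R' T' : pzAlgType K).
Variables (u : {pzalgmorphism R -> A}) (v : {pzalgmorphism T -> A}).
Variables (u' : {pzalgmorphism R' -> A}) (v' : {pzalgmorphism T' -> A}).

Let tens_sides (x : alg_bimod u j) (y : alg_bimod j v) :
    tensor_sort (alg_bimod u' j) (alg_bimod j v') :=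
  tens (x : alg_bimod u' j) (y : alg_bimod j v').

Lemma balanced_tens_sides : balanced tens_sides.
Proof. by case: (tens_balanced (alg_bimod u' j) (alg_bimod j v')). Qed.

Definition change_sides :
    tensor_sort (alg_bimod u j) (alg_bimod j v) ->
    tensor_sort (alg_bimod u' j) (alg_bimod j v') :=
  tensor_lift tens_sides.

Lemma change_sidesE (x y : A) :
  change_sides (tens (x : alg_bimod u j) (y : alg_bimod j v)) =
  tens (x : alg_bimod u' j) (y : alg_bimod j v').
Proof. exact: tensor_liftE balanced_tens_sides. Qed.

Lemma change_sidesD : {morph change_sides : t t' / t + t'}.
Proof. exact: tensor_liftD balanced_tens_sides. Qed.

Lemma change_sides_lact a a' t :
  u a = u' a' -> change_sides (tensor_lact a t) = tensor_lact a' (change_sides t).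
Proof.
move=> aa'; move: t; apply: tensor_ext => [t t'|t t'|x y].
- by rewrite lactD_tensor change_sidesD.
- by rewrite change_sidesD lactD_tensor.
- rewrite [tensor_lact _ _]lact_tens !change_sidesE [RHS]lact_tens /=.
  by rewrite aa'.
Qed.

Lemma change_sides_ract t a a' :
  v a = v' a' -> change_sides (tensor_ract t a) = tensor_ract (change_sides t) a'.
Proof.
move=> aa'; move: t; apply: tensor_ext => [t t'|t t'|x y].
- by rewrite ractD_tensor change_sidesD.
- by rewrite change_sidesD ractD_tensor.
- rewrite [tensor_ract _ _]ract_tens !change_sidesE [RHS]ract_tens /=.
  by rewrite aa'.
Qed.

End Identity.

Arguments change_sides {R T R' T'} u v u' v' t.

Lemma change_sidesK (R T R' T' : pzAlgType K)
    (u : {pzalgmorphism R -> A}) (v : {pzalgmorphism T -> A})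
    (u' : {pzalgmorphism R' -> A}) (v' : {pzalgmorphism T' -> A}) :
  cancel (change_sides u v u' v') (change_sides u' v' u v).
Proof.
by apply: tensor_ext => [t t'|//|x y]; rewrite ?change_sidesD ?change_sidesE.
Qed.

(** Restriction of scalars along [p] and [q] keeps the maps that witness
    [dominated]: they only have to be transported by [change_sides]. *)
Lemma dominated_restrict (R T R' T' : pzAlgType K)
    (u : {pzalgmorphism R -> A}) (v : {pzalgmorphism T -> A})
    (u' : {pzalgmorphism R' -> A}) (v' : {pzalgmorphism T' -> A})
    (p : R' -> R) (q : T' -> T) :
  u' =1 u \o p -> v' =1 v \o q ->
  dominated (tensor (alg_bimod u j) (alg_bimod j v)) (alg_bimod u v) ->
  dominated (tensor (alg_bimod u' j) (alg_bimod j v')) (alg_bimod u' v').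
Proof.
move=> u'E v'E [I [f [g [I_gt0 hf hg gfK]]]].
pose sg := change_sides u' v' u v; pose rt := change_sides u v u' v'.
exists I, (fun k => f k \o sg), (fun k => rt \o g k); split=> // [k|k|x].
- split=> [x y|r x|x s] /=; first by rewrite /sg change_sidesD (bimod_homD (hf k)).
  + rewrite /sg (change_sides_lact _ _ (u'E r)) u'E.
    exact: (bimod_homl (hf k)).
  + rewrite /sg (change_sides_ract _ _ (v'E s)) v'E.
    exact: (bimod_homr (hf k)).
- split=> [x y|r x|x s] /=.
  + by rewrite (bimod_homD (hg k)) /rt change_sidesD.
  + rewrite u'E -(change_sides_lact _ _ (esym (u'E r))) /rt; congr change_sides.
    exact: (bimod_homl (hg k)).
  + rewrite v'E -(change_sides_ract _ _ (esym (v'E s))) /rt; congr change_sides.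
    exact: (bimod_homr (hg k)).
- by rewrite -(morphD_sum (@change_sidesD _ _ _ _ u v u' v')) gfK change_sidesK.
Qed.

End ChangeOfSides.

(** * H-separable extensions *)

Section Hseparable.
Variables (K : comPzRingType) (A B C : pzAlgType K).
Variables (i : {pzalgmorphism B -> C}) (j : {pzalgmorphism C -> A}).

Local Notation CBC := (tensor (alg_bimod idfun i) (alg_bimod i idfun)).

(** For x and y in [A], [sandwich x y] is the map
    c (x)_B d |-> x c (x)_B d y, so that [sandwich x y e] is the element x e y of
    A (x)_B A obtained by letting [A] act on the image of [e]. *)
Section Sandwich.
Variables (R T : pzAlgType K).
Variables (u : {pzalgmorphism R -> A}) (v : {pzalgmorphism T -> A}).

Local Notation ABA := (tensor (alg_bimod u (j \o i)) (alg_bimod (j \o i) v)).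
Local Notation ACA := (tensor (alg_bimod u j) (alg_bimod j v)).

Let sandwich_map (x y : A) (c : alg_bimod idfun i) (d : alg_bimod i idfun) :
    ABA :=
  tens (x * j c : alg_bimod u (j \o i)) (j d * y : alg_bimod (j \o i) v).

Lemma balanced_sandwich x y : balanced (sandwich_map x y).
Proof.
have [tDl tDr tM] :=
  @tens_balanced K R B T (alg_bimod u (j \o i)) (alg_bimod (j \o i) v).
rewrite /sandwich_map; split=> [c c' d|c d d'|c b d].
- by rewrite rmorphD mulrDr tDl.
- by rewrite rmorphD mulrDl tDr.
- by rewrite /= !rmorphM mulrA [LHS]tM /= mulrA.
Qed.

Definition sandwich (x y : A) : CBC -> ABA := tensor_lift (sandwich_map x y).

Lemma sandwichE x y c d :
  sandwich x y (tens c d) =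
  tens (x * j c : alg_bimod u (j \o i)) (j d * y : alg_bimod (j \o i) v).
Proof. exact: tensor_liftE (balanced_sandwich x y). Qed.

Lemma sandwichD x y : {morph sandwich x y : e e' / e + e'}.
Proof. exact: tensor_liftD (balanced_sandwich x y). Qed.

Lemma sandwichDl e y : {morph sandwich^~ y ^~ e : x x' / x + x'}.
Proof.
move=> x x'; move: e; apply: tensor_ext => [e e'|e e'|c d].
- by rewrite sandwichD.
- by rewrite !sandwichD addrACA.
- by rewrite !sandwichE mulrDl (balancedDl (tens_balanced _ _)).
Qed.

Lemma sandwichDr e x : {morph (sandwich x)^~ e : y y' / y + y'}.
Proof.
move=> y y'; move: e; apply: tensor_ext => [e e'|e e'|c d].
- by rewrite sandwichD.
- by rewrite !sandwichD addrACA.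
- by rewrite !sandwichE mulrDr (balancedDr (tens_balanced _ _)).
Qed.

Lemma sandwich_lact x y c e : sandwich x y (lact c e) = sandwich (x * j c) y e.
Proof.
move: e; apply: tensor_ext => [e e'|e e'|d d'].
- by rewrite lactDr sandwichD.
- by rewrite sandwichD.
- by rewrite lact_tens !sandwichE /= rmorphM mulrA.
Qed.

Lemma sandwich_ract x y c e : sandwich x y (ract e c) = sandwich x (j c * y) e.
Proof.
move: e; apply: tensor_ext => [e e'|e e'|d d'].
- by rewrite ractDl sandwichD.
- by rewrite sandwichD.
- by rewrite ract_tens !sandwichE /= rmorphM mulrA.
Qed.

Lemma lact_sandwich r x y e : lact r (sandwich x y e) = sandwich (u r * x) y e.
Proof.
move: e; apply: tensor_ext => [e e'|e e'|d d'].
- by rewrite sandwichD lactDr.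
- by rewrite sandwichD.
- by rewrite !sandwichE lact_tens /= mulrA.
Qed.

Lemma ract_sandwich s x y e : ract (sandwich x y e) s = sandwich x (y * v s) e.
Proof.
move: e; apply: tensor_ext => [e e'|e e'|d d'].
- by rewrite sandwichD ractDl.
- by rewrite sandwichD.
- by rewrite !sandwichE ract_tens /= mulrA.
Qed.

(** The morphisms [f k] and [g k] given by H-separability are determined by the
    elements [r k], the image of 1 (x) 1, and [e k], the image of 1.  As 1 (x) 1
    commutes with [B], so does [r k]; as 1 commutes with [C], so does [e k].
    These two facts are what makes the maps x (x) y |-> x r_k (x) y and
    x (x) y |-> x e_k y balanced. *)
Lemma dominated_Hseparable : Hseparable i -> dominated ABA ACA.
Proof.
move=> /dominatedP[I [f [g [I_gt0 hf hg gfK]]]].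
pose one2 : CBC := tens (1 : alg_bimod idfun i) (1 : alg_bimod i idfun).
pose r k : C := f k one2.
pose e k : CBC := g k (1 : C).
have rB k b : i b * r k = r k * i b.
  rewrite /r /one2 -[LHS](bimod_homl (hf k)) -[RHS](bimod_homr (hf k)).
  rewrite lact_tens ract_tens /= mulr1 mul1r; congr (f k _).
  have [_ _ /(_ 1 b 1) /=] :=
    @tens_balanced K C B C (alg_bimod idfun i) (alg_bimod i idfun).
  by rewrite mul1r mulr1.
have eC k c : lact c (e k) = ract (e k) c.
  by rewrite -(bimod_homl (hg k)) -(bimod_homr (hg k)) /= mulr1 mul1r.
have re1 : \sum_k lact (r k) (e k) = one2.
  rewrite -[RHS]gfK; apply: eq_bigr => k _.
  by rewrite -(bimod_homl (hg k)) /= mulr1.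
pose th k (x : alg_bimod u (j \o i)) (y : alg_bimod (j \o i) v) : ACA :=
  tens (x * j (r k) : alg_bimod u j) (y : alg_bimod j v).
pose ph k (x : alg_bimod u j) (y : alg_bimod j v) : ABA := sandwich x y (e k).
have bth k : balanced (th k).
  have [tDl tDr tM] := @tens_balanced K R C T (alg_bimod u j) (alg_bimod j v).
  rewrite /th; split=> [x x' y|x y y'|x b y]; first by rewrite mulrDl tDl.
    by rewrite tDr.
  rewrite /= -mulrA -rmorphM rB rmorphM mulrA; exact: tM.
have bph k : balanced (ph k).
  rewrite /ph; split=> [x x' y|x y y'|x c y]; first exact: sandwichDl.
    exact: sandwichDr.
  by rewrite /= -sandwich_lact eC sandwich_ract.
have hth k : bimod_hom (tensor_lift (th k) : ABA -> ACA).
  apply: tensor_lift_hom => // [a x y|x y a].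
  - by rewrite /th lact_tens /= mulrA.
  - by rewrite /th ract_tens.
have hph k : bimod_hom (tensor_lift (ph k) : ACA -> ABA).
  apply: tensor_lift_hom => // [a x y|x y a].
  - by rewrite /ph lact_sandwich.
  - by rewrite /ph ract_sandwich.
exists I, (fun k => tensor_lift (th k)), (fun k => tensor_lift (ph k)).
split=> //; apply: tensor_ext => [||x y].
- apply: morphD_sumf => k; exact: bimod_homD (bimod_hom_comp (hph k) (hth k)).
- by [].
transitivity (sandwich x y (\sum_k lact (r k) (e k))).
  rewrite (morphD_sum (sandwichD x y)); apply: eq_bigr => k _.
  by rewrite (tensor_liftE _ _ (bth k)) (tensor_liftE _ _ (bph k)) sandwich_lact.
by rewrite re1 sandwichE !rmorph1 mulr1 mul1r.
Qed.

End Sandwich.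

End Hseparable.

(** * Transitivity of the depth two condition *)

Theorem proposition3p2 (K : comPzRingType) (A B C : pzAlgType K)
    (i : {pzalgmorphism B -> C}) (j : {pzalgmorphism C -> A}) :
  (right_D2 j -> Hseparable i -> right_D2 (j \o i)) /\
  (left_D2 j -> Hseparable i -> left_D2 (j \o i)).
Proof.
split=> /dominatedP D2j Hi; apply/dominatedP.
  apply: dominated_trans (dominated_Hseparable j idfun (j \o i) Hi) _.
  exact: (dominated_restrict (p := idfun) (q := i) _ _ D2j).
apply: dominated_trans (dominated_Hseparable j (j \o i) idfun Hi) _.
exact: (dominated_restrict (p := i) (q := idfun) _ _ D2j).
Qed.
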